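(* Let $0<p<1$ be a constant probability and $s\ge 3$ be an integer. Then, with high probability (i.e., with probability tending to $1$ as $n\to\infty$), \[ w\text{-}sat(G(n,p),K_s) = (s-2)n-\binom{s-1}{2}. \]
   Context: $G(n,p)$ denotes the Erdős–Rényi random graph on vertex set $[n]$ in which each pair of vertices is an edge independently with probability $p$. $K_s$ is the complete graph on $s$ vertices. For graphs $G$ and $F$, a subgraph $H\subseteq G$ is weakly $F$-saturated in $G$ if $H$ contains no copy of $F$, but the edges of $G$ missing from $H$ can be added to $H$ one by one in some order so that each added edge creates a new copy of $F$. $w\text{-}sat(G,F)$ denotes the minimum number of edges of a weakly $F$-saturated graph in $G$. *)

(* Defs.v *)
From HB Require Import structures.
From mathcomp Require Import all_boot all_order all_algebra.
From mathcomp Require Import all_classical all_reals all_analysis.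

Set Implicit Arguments.
Unset Strict Implicit.
Unset Printing Implicit Defensive.

Import Order.TTheory GRing.Theory Num.Theory.
Import numFieldNormedType.Exports.

Local Open Scope ring_scope.

Definition pairs (T : finType) : {set {set T}} := [set e : {set T} | #|e| == 2%N].

Record sgraph (T : finType) :=
  SGraph { edges : {set {set T}}; edges_pairs : edges \subset pairs T }.

HB.instance Definition _ (T : finType) := [isSub for @edges T].
HB.instance Definition _ (T : finType) := [Finite of sgraph T by <:].

Definition complete_graph (T : finType) : sgraph T :=
  SGraph (subxx (pairs T)).

Section WeakSaturation.
Variables (U T : finType) (F : sgraph U).
Implicit Types (A C : {set {set T}}) (G H : sgraph T).

(* Graphs on T all have the full vertex set T, so a copy of F is determined,
   as far as containment is concerned, by its edge set. *)
Definition is_copy C : Prop :=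
  exists2 f : U -> T, injective f & C = [set f @: (e : {set U}) | e in edges F].

Definition copy_free A : Prop := forall C, is_copy C -> ~~ (C \subset A).

Definition creates_copy A (e : {set T}) : Prop :=
  exists C, [/\ is_copy C, C \subset e |: A & ~~ (C \subset A)].

Fixpoint saturating A (es : seq {set T}) : Prop :=
  if es is e :: es' then creates_copy A e /\ saturating (e |: A) es' else True.

Definition weakly_saturated G H : Prop :=
  [/\ edges H \subset edges G,
      copy_free (edges H) &
      exists2 es, perm_eq es (enum (edges G :\: edges H)) &
                  saturating (edges H) es].

(* When F has an edge, a weakly F-saturated subgraph always exists, so the
   default value #|edges G| plays no role: see wsat_spec. *)
Definition wsat G : nat :=
  #|edges [arg min_(H < G | `[< weakly_saturated G H >]) #|edges H| ]%N|.

Lemma weakly_saturated_exists G :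
  edges F != finset.set0 -> exists H, weakly_saturated G H.
Proof.
move=> F0.
suff main m H es : (#|edges H| <= m)%N -> edges H \subset edges G ->
    perm_eq es (enum (edges G :\: edges H)) -> saturating (edges H) es ->
    exists H', weakly_saturated G H'.
  by apply: (main _ G [::] (leqnn _)) => //; rewrite finset.setDv enum_set0.
elim: m H es => [|m IH] H es Hm HG pes ses;
  have [free|] := pselect (copy_free (edges H));
  try by exists H; split => //; exists es.
- case=> C [f _ ->]; apply/negP => sub.
  have [e eF] := set0Pn _ F0.
  have := fintype.subsetP sub _ (imset_f (fun e : {set U} => f @: e) eF).
  by move: Hm; rewrite leqn0 cards_eq0 => /eqP ->; rewrite finset.inE.
move=> /existsNP[C] /not_implyP[copyC] /negP/negPn CH.
have [e eC] : exists e, e \in C.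
  have [e eF] := set0Pn _ F0.
  by case: copyC => f _ ->; exists (f @: e); apply: imset_f.
have eH := fintype.subsetP CH _ eC.
have sub : edges H :\ e \subset pairs T.
  exact: fintype.subset_trans (subD1set _ _) (edges_pairs H).
apply: (IH (SGraph sub) (e :: es)) => /=.
- by move: Hm; rewrite (cardsD1 e (edges H)) eH.
- exact: fintype.subset_trans (subD1set _ _) HG.
- apply: uniq_perm; rewrite ?enum_uniq //=.
    by rewrite (perm_uniq pes) enum_uniq (perm_mem pes) mem_enum !finset.inE eH.
  move=> x; rewrite inE (perm_mem pes) !mem_enum !finset.inE.
  case: eqP => [->|_] //=.
  by rewrite (fintype.subsetP HG _ eH).
- split; last by rewrite finset.setD1K.
  exists C; rewrite finset.setD1K //; split => //.
  by apply/subsetPn; exists e; rewrite // !finset.inE eqxx.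
Qed.

Lemma wsat_spec G : edges F != finset.set0 ->
  exists2 H, weakly_saturated G H /\ #|edges H| = wsat G &
             forall H', weakly_saturated G H' -> (wsat G <= #|edges H'|)%N.
Proof.
move=> F0; rewrite /wsat; set P := fun H => `[< weakly_saturated G H >].
have [H0 /asboolP PH0] := weakly_saturated_exists G F0.
rewrite /fintype.arg_min /extremum.
case: (pickP) => [H /andP[/asboolP PH /forallP minH]|none] /=.
  exists H => // H' /asboolP PH'.
  by have /implyP/(_ PH') := minH H'.
have [H PH minH] : exists2 H, P H & forall H', P H' -> (#|edges H| <= #|edges H'|)%N.
  by case: (@fintype.arg_minnP _ H0 P (fun H => #|edges H|) PH0) => H PH minH; exists H.
have /negP[] := negbT (none H); apply/andP; split; first exact: PH.
by apply/forallP => H'; apply/implyP => /minH.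
Qed.

End WeakSaturation.

Section ErdosRenyi.
Variables (R : realType) (n : nat) (p : R).

(* The law of G(n,p): the product over all pairs of Bernoulli(p) laws. *)
Definition gnp_mass (G : sgraph 'I_n) : R :=
  \prod_(e in pairs 'I_n) (if e \in edges G then p else 1 - p).

Definition gnp_prob (A : pred (sgraph 'I_n)) : R := \sum_(G | A G) gnp_mass G.

Lemma gnp_prob_total : gnp_prob predT = 1.
Proof.
have -> : gnp_prob predT = \sum_(E : {set {set 'I_n}} | E \subset pairs 'I_n)
    \prod_(e in pairs 'I_n) (if e \in E then p else 1 - p).
  rewrite (reindex_omap (@edges 'I_n) insub); last first.
    by move=> E EP; rewrite insubT.
  by apply: eq_bigl => G; rewrite valK eqxx andbT edges_pairs.
transitivity (\prod_(e : {set 'I_n}) ((if e \in pairs 'I_n then p else 0) +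
                                (if e \in pairs 'I_n then 1 - p else 1))).
  rewrite bigA_distr [RHS](bigID (fun E : {set {set 'I_n}} => E \subset pairs 'I_n)) /=.
  rewrite [X in _ = _ + X]big1 ?addr0 => [|E /subsetPn[e eE /negPf eP]]; last first.
    by rewrite (bigD1 e) //= eE eP mul0r.
  apply: eq_big => // E EP; rewrite big_mkcond /=; apply: eq_bigr => e _.
  case: ifPn => // eP; case: ifPn => // /(fintype.subsetP EP).
  by rewrite (negPf eP).
by apply: big1 => e _; case: ifP => _; rewrite ?add0r // addrC subrK.
Qed.

End ErdosRenyi.

(* Main.v *)
(** Write [d = s - 2].

    Lower bound: to the pair [{i, j}] attach the [n * d] matrix over the
    rationals with row [j] equal to [(t_i ^ k)_k], row [i] equal to
    [- (t_j ^ k)_k] and zeros elsewhere.  On [d + 2] vertices with Lagrange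
    weights [l_a], the relation with coefficients [l_a l_b (t_b - t_a)] involves
    every pair, so adding an edge that creates a copy of [K_s] never enlarges the
    span of the edges.  The pairs meeting the first [d] vertices are independent,
    and with high probability every pair has a [d]-clique in its common
    neighbourhood, so the span of a weakly saturated graph has dimension at least
    ['C(n, 2) - 'C(n - d, 2) = d n - 'C(d + 1, 2)].

    Upper bound: let [Z1] and [Z] be the first [k d] and [k ^ 4 d] vertices, where
    [2 ^ k ^ 3 <= n < 2 ^ k.+1 ^ 3].  With high probability some [d]-clique [Q]
    outside [Z] is completely joined to [Z1], every at most [d + 2] vertices of [Z]
    have a common [d]-clique of neighbours in [Z1], and every at most [d + 2]
    vertices have one in [Z].  Take all pairs inside [Q] and join each vertex of
    [Z1] to [Q], each other vertex of [Z] to a [d]-clique in [Z1], and each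
    remaining one to a [d]-clique in [Z].  These ['C(d, 2) + (n - d) d] edges
    infect, in turn, all edges of [G] within [Z1], within [Z], between [Z] and
    the rest, and finally everywhere.  The failure probabilities reduce to the fact that, for disjoint edge sets [D_i], none is
    contained in [G(n, p)] with probability [prod_i (1 - p ^ |D_i|)]. *)
Require Import Defs.
From mathcomp Require Import all_boot all_order all_algebra.
From mathcomp Require Import reals.
From mathcomp Require Import zify ring lra.

Set Implicit Arguments.
Unset Strict Implicit.
Unset Printing Implicit Defensive.

Import Order.TTheory GRing.Theory Num.Theory.
Local Open Scope ring_scope.

(** * Vanishing moments and Lagrange weights *)

Lemma size_prod_XsubC_pred (F : idomainType) (I : finType) (P : pred I) (t : I -> F) :
  size (\prod_(i | P i) ('X - (t i)%:P)) = #|P|.+1.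
Proof. by rewrite -big_enum size_prod_XsubC cardE. Qed.

Section Moments.
Variables (F : fieldType) (I : finType) (t : I -> F).
Hypothesis t_inj : injective t.

Lemma sum_horner_eq0 d (c : I -> F) (P : {poly F}) :
  (forall k, (k < d)%N -> \sum_i c i * t i ^+ k = 0) ->
  (size P <= d)%N -> \sum_i c i * P.[t i] = 0.
Proof.
move=> ck szP.
under eq_bigr => i _ do rewrite horner_coef mulr_sumr.
rewrite exchange_big /= big1 // => k _.
under eq_bigr => i _ do rewrite mulrCA.
by rewrite -mulr_sumr ck ?mulr0 // (leq_trans (ltn_ord k)).
Qed.

(** Testing [c] against the polynomial vanishing on [A :\ i], of degree below [#|A|], isolates [c i]
    times a nonzero value; this is the invertibility of a Vandermonde matrix. *)
Lemma moments_inj (A : {set I}) (c : I -> F) :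
  (forall i, i \notin A -> c i = 0) ->
  (forall k, (k < #|A|)%N -> \sum_i c i * t i ^+ k = 0) ->
  forall i, c i = 0.
Proof.
move=> cA ck i; have [iA|/cA//] := boolP (i \in A).
pose P := \prod_(j in A :\ i) ('X - (t j)%:P).
have szP : size P = #|A|.
  by rewrite size_prod_XsubC_pred [RHS](cardsD1 i) iA.
have := sum_horner_eq0 ck (eq_leq szP).
rewrite (bigD1 i) //= big1 => [|j ji]; last first.
  have [jA|/cA ->] := boolP (j \in A); last by rewrite mul0r.
  by rewrite horner_prod (bigD1 j) ?inE ?ji //= hornerXsubC subrr mul0r mulr0.
rewrite addr0 => /eqP; rewrite mulf_eq0 => /orP[/eqP//|].
rewrite horner_prod => /prodf_eq0[j]; rewrite !inE => /andP[ji _].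
by rewrite hornerXsubC subr_eq0 => /eqP/t_inj/esym/eqP; rewrite (negPf ji).
Qed.

(** The barycentric weights of Lagrange interpolation at the nodes [t]. *)
Definition lagrange_weight i := \prod_(j | j != i) (t i - t j)^-1.

Lemma lagrange_weight_neq0 i : lagrange_weight i != 0.
Proof.
apply/prodf_neq0 => j ji; rewrite invr_eq0 subr_eq0.
by apply: contra ji => /eqP/t_inj->.
Qed.

(* The weighted moments are the top coefficients in Lagrange's interpolation
   formula for 'X^m. *)
Lemma sum_lagrange_weight m :
  (m.+1 < #|I|)%N -> \sum_i lagrange_weight i * t i ^+ m = 0.
Proof.
move=> mI.
pose L i := \prod_(j | j != i) ('X - (t j)%:P).
have szL i : size (L i) = #|I|.
  rewrite /L size_prod_XsubC_pred cardC1.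
  by rewrite prednK // (leq_ltn_trans _ mI).
have monL i : L i \is monic by apply: monic_prod_XsubC.
pose S := \sum_i (lagrange_weight i * t i ^+ m) *: L i.
have SX : S = 'X^m.
  apply/eqP; rewrite -subr_eq0; apply/eqP.
  (* The difference has size at most [#|I|] and vanishes at [#|I|] distinct nodes. *)
  apply: (@roots_geq_poly_eq0 _ _ [seq t i | i : I]).
  - apply/allP => _ /mapP[i _ ->]; rewrite rootE !hornerE.
    rewrite horner_sum (bigD1 i) //= big1 => [|j ji].
      rewrite addr0 !hornerE horner_prod mulrAC /lagrange_weight.
      rewrite -[X in X * _](_ : 1 = _) ?mul1r ?subrr //.
      rewrite -big_split /=; symmetry; apply: big1 => j ji.
      rewrite hornerXsubC mulVf // subr_eq0.
      by apply: contra ji => /eqP/t_inj->.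
    rewrite !hornerE horner_prod (bigD1 i) 1?eq_sym //=.
    by rewrite hornerXsubC subrr mul0r mulr0.
  - by rewrite map_inj_uniq // enum_uniq.
  - rewrite size_map -cardE (leq_trans (size_polyD _ _)) // geq_max size_polyN.
    rewrite size_polyXn (ltnW mI) andbT.
    apply: (leq_trans (size_sum _ _ _)); apply/bigmax_leqP => i _.
    by rewrite (leq_trans (size_scale_leq _ _)) // szL.
have := congr1 (fun P : {poly F} => P`_(#|I|.-1)) SX.
rewrite /= coefXn coef_sum (_ : (_ == m) = false); last first.
  by rewrite gtn_eqF // -ltnS prednK // (leq_ltn_trans _ mI).
rewrite mulr0n => S0; rewrite -[RHS]S0; apply: eq_bigr => i _; rewrite coefZ.
by have := monicP (monL i); rewrite lead_coefE szL => ->; rewrite mulr1.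
Qed.

End Moments.

(** * Edge vectors and the dimension lower bound *)

Lemma card_ord_ltn n m : (m <= n)%N -> #|[set i : 'I_n | (i < m)%N]| = m.
Proof.
by move=> mn; rewrite -sum1dep_card -(big_ord_widen _ (fun=> 1%N)) // sum1_card card_ord.
Qed.

Section EdgeVectors.
Variables n d : nat.
Local Notation V := 'M[rat]_(n, d).
Implicit Types (A : {set {set 'I_n}}) (e : {set 'I_n}) (U : {vspace V}).

Definition node (i : 'I_n) : rat := (i : nat)%:R.

Lemma node_inj : injective node.
Proof. by move=> i j /eqP; rewrite eqr_nat => /eqP/val_inj. Qed.

Definition arc_vec (i j : 'I_n) : V :=
  \matrix_(x, k) ((x == j)%:R * node i ^+ k - (x == i)%:R * node j ^+ k).

Lemma arc_vecC i j : arc_vec j i = - arc_vec i j.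
Proof. by apply/matrixP => x k; rewrite !mxE opprB. Qed.

(** The two halves of [arc_vec] contribute equally by antisymmetry; a linear relation between arc
    vectors thus becomes the vanishing of moments of the columns of [C]. *)
Lemma sum_arc_vec (I : finType) (f : I -> 'I_n) (C : I -> I -> rat) x k :
  (forall a b, C b a = - C a b) ->
  (\sum_a \sum_b C a b *: arc_vec (f a) (f b)) x k =
  2 * \sum_b (x == f b)%:R * \sum_a C a b * node (f a) ^+ k.
Proof.
move=> CN; rewrite summxE.
transitivity (\sum_a \sum_b (x == f b)%:R * (C a b * node (f a) ^+ k)
            + \sum_a \sum_b (x == f a)%:R * (C b a * node (f b) ^+ k)).
  rewrite -big_split /=; apply: eq_bigr => a _.
  rewrite summxE -big_split /=; apply: eq_bigr => b _.
  by rewrite !mxE (CN a b); ring.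
rewrite [X in X + _]exchange_big /= -mulr2n mulr_natl; congr (_ *+ 2).
by apply: eq_bigr => b _; rewrite mulr_sumr.
Qed.

(** On a pair exactly one ordered term survives; summing avoids a choice of endpoints. *)
Definition edge_vec e : V :=
  \sum_(i in e) \sum_(j in e | (i < j)%N) arc_vec i j.

Lemma edge_vec_lt (i j : 'I_n) : (i < j)%N -> edge_vec [set i; j] = arc_vec i j.
Proof.
move=> ij; have nij : i != j by rewrite -val_eqE neq_ltn ij.
rewrite /edge_vec big_setU1 ?inE //= big_set1.
rewrite (big_pred1 j) => [|k]; last first.
  rewrite !inE; case: (eqVneq k i) => [->|_] /=; last first.
    by case: eqVneq => [->|].
  by rewrite ltnn (negPf nij).
rewrite [X in _ + X]big1 ?addr0 // => k; rewrite !inE.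
by case/andP => /orP[]/eqP->; lia.
Qed.

Lemma edge_vecE (i j : 'I_n) : i != j ->
  edge_vec [set i; j] = arc_vec i j \/ edge_vec [set i; j] = - arc_vec i j.
Proof.
rewrite -val_eqE neq_ltn => /orP[ij|ji]; first by left; apply: edge_vec_lt.
by right; rewrite setUC edge_vec_lt // arc_vecC.
Qed.

Lemma arc_vec_mem U (i j : 'I_n) : i != j -> (edge_vec [set i; j] \in U) = (arc_vec i j \in U).
Proof. by move=> /edge_vecE[]->; rewrite ?rpredN. Qed.

Definition edge_span A : {vspace V} := <<[seq edge_vec e | e <- enum A]>>%VS.

Lemma edge_vec_span A e : e \in A -> edge_vec e \in edge_span A.
Proof. by move=> eA; apply/memv_span/map_f; rewrite mem_enum. Qed.

Lemma edge_span_sub A U :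
  (forall e, e \in A -> edge_vec e \in U) -> (edge_span A <= U)%VS.
Proof.
by move=> AU; apply/span_subvP => _ /mapP[e eA ->]; apply: AU; rewrite -mem_enum.
Qed.

Lemma dim_edge_span A : (\dim (edge_span A) <= #|A|)%N.
Proof. by rewrite (leq_trans (dim_span _)) // size_map -cardE. Qed.

(** The antisymmetric coefficients [l a * l b * (t b - t a)] give a vanishing combination, and the
    one at [(a0, b0)] is nonzero, so that vector is a combination of the others. *)
Lemma clique_edge_vec_span (f : 'I_d.+2 -> 'I_n) U a0 b0 :
  injective f -> a0 != b0 ->
  (forall a b, a != b -> [set f a; f b] != [set f a0; f b0] ->
     arc_vec (f a) (f b) \in U) ->
  arc_vec (f a0) (f b0) \in U.
Proof.
move=> f_inj ab0 memU.
pose t a := node (f a).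
have t_inj : injective t by move=> a b /node_inj/f_inj.
pose l := lagrange_weight t.
pose C a b := l a * l b * (t b - t a).
have CN a b : C b a = - C a b by rewrite /C; ring.
have sum0 : \sum_a \sum_b C a b *: arc_vec (f a) (f b) = 0.
  apply/matrixP => x k; rewrite sum_arc_vec // mxE big1 ?mulr0 // => b _.
  rewrite (_ : \sum_a _ = 0) ?mulr0 //.
  (* Column [b] involves the moments of orders [k] and [k + 1], at most [d], which vanish on [d + 2]
     nodes. *)
  transitivity (l b * (t b * \sum_a l a * t a ^+ k - \sum_a l a * t a ^+ k.+1)).
    rewrite mulr_sumr -sumrB mulr_sumr; apply: eq_bigr => a _.
    by rewrite /C exprS -/(t a); ring.
  by rewrite !sum_lagrange_weight ?card_ord ?mulr0 ?subr0 ?mulr0 // !ltnS // ltnW.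
have C0 : C a0 b0 != 0.
  rewrite !mulf_neq0 ?lagrange_weight_neq0 // subr_eq0.
  by apply: contra ab0 => /eqP/t_inj->.
have : \sum_a \sum_b C a b *: arc_vec (f a) (f b) \in U by rewrite sum0 mem0v.
(* Both orders of the pair give the same term, so the total coefficient is twice [C a0 b0]. *)
rewrite pair_bigA /= (bigD1 (a0, b0)) //= (bigD1 (b0, a0)) /=; last first.
  by rewrite xpair_eqE eq_sym (negPf ab0).
rewrite (CN a0 b0) (arc_vecC (f a0) (f b0)) scalerN scaleNr opprK addrA -scalerDl.
rewrite rpredDr; last first.
  apply: rpred_sum => -[a b] /= /andP[/negPf ne1 /negPf ne2].
  have [->|ab] := eqVneq a b; first by rewrite /C subrr mulr0 scale0r mem0v.
  apply/memvZ/memU => //; apply/eqP => E.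
  have: f a \in [set f a0; f b0] by rewrite -E !inE eqxx.
  have: f b \in [set f a0; f b0] by rewrite -E !inE eqxx orbT.
  rewrite !inE !(inj_eq f_inj).
  move=> /orP[]/eqP hb /orP[]/eqP ha; subst a b; move: ab ne1 ne2;
  by rewrite ?eqxx.
rewrite rpredZeq -mulr2n mulrn_eq0 /= => /orP[/eqP Cz|//].
by rewrite Cz eqxx in C0.
Qed.

(** The copy is a clique whose only edge outside [A] is [e], so the clique relation can be solved
    for the vector of [e]. *)
Lemma creates_copy_span A e :
  creates_copy (complete_graph 'I_d.+2) A e ->
  edge_vec e \in edge_span A.
Proof.
move=> [_ [[f f_inj ->] sub nsub]].
have [h hK hA] := subsetPn nsub.
have he : h = e by have := subsetP sub _ hK; rewrite !inE (negPf hA) orbF => /eqP.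
move: hK; rewrite he => /imsetP[e0 + eE]; rewrite inE => /cards2P[a0 [b0 [ab0 e0E]]].
have {}eE : e = [set f a0; f b0] by rewrite eE e0E imsetU1 imset_set1.
rewrite {1}eE arc_vec_mem ?(inj_eq f_inj) //.
apply: clique_edge_vec_span => // a b ab ne.
rewrite -arc_vec_mem ?(inj_eq f_inj) //; apply: edge_vec_span.
have : [set f a; f b] \in e |: A.
  apply/(subsetP sub)/imsetP; exists [set a; b]; rewrite ?inE ?cards2 ?ab //.
  by rewrite imsetU1 imset_set1.
by rewrite !inE eE (negPf ne).
Qed.

Lemma saturating_span A es :
  saturating (complete_graph 'I_d.+2) A es ->
  forall e, e \in es -> edge_vec e \in edge_span A.
Proof.
elim: es A => [//|e es IH] A /= [/creates_copy_span eA /IH{}IH] h.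
rewrite inE => /orP[/eqP->//|/IH]; apply: (subvP (edge_span_sub _)) => g.
by rewrite !inE => /orP[/eqP->//|/edge_vec_span].
Qed.

Definition star_edges : {set {set 'I_n}} :=
  [set e in pairs 'I_n | [exists i in e, (i < d)%N]].

(** The pairs avoiding the first [d] vertices are the pairs among the remaining [n - d]. *)
Lemma card_star_edges : (#|star_edges| + 'C(n - d, 2) = 'C(n, 2))%N.
Proof.
rewrite -[in RHS](card_ord n) -(card_draws _ 2).
rewrite (_ : [set A : {set 'I_n} | #|A| == 2] = pairs 'I_n) //.
rewrite -(cardsID star_edges (pairs 'I_n)) (setIidPr _); last first.
  by apply/subsetP => e; rewrite inE => /andP[].
congr addn; have -> : (n - d = #|[set i : 'I_n | (d <= i)%N]|)%N.
  transitivity (\sum_(d <= i < n) 1)%N; first by rewrite sum_nat_const_nat muln1.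
  by rewrite big_geq_mkord -sum1dep_card.
rewrite -cards_draws; apply: eq_card => e; rewrite !inE.
case: (#|e| == 2%N) => /=; rewrite ?andbF ?andbT //.
apply/subsetP/existsPn => H i; have := H i; rewrite !inE negb_and -leqNgt.
  by case: (i \in e) => //= ->.
by case: (i \in e) => //=.
Qed.

(** A vanishing combination gives an antisymmetric matrix [C] whose columns have zero moments below
    order [d]. Columns beyond the first [d] are supported on [d] rows, hence zero; antisymmetry then
    confines the other columns to the same rows. *)
Lemma star_edges_free :
  (d <= n)%N -> (#|star_edges| <= \dim (edge_span star_edges))%N.
Proof.
move=> dn; set E := star_edges.
pose X := [tuple edge_vec (enum_val i) | i < #|E|].
have subX : (<<X>> <= edge_span E)%VS.
  by apply/span_subvP => _ /mapP[i _ ->]; apply/edge_vec_span/enum_valP.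
suff /eqP Xfree : free X by rewrite (leq_trans _ (dimvS subX)) // Xfree size_tuple.
apply/freeP => c sum0.
(* Reindex the coefficients by edges, with value zero outside [E]. *)
pose c' e := \sum_(i : 'I_#|E| | enum_val i == e) c i.
have c'0 e : e \notin E -> c' e = 0.
  by move=> eE; apply: big_pred0 => i; apply: contraNF eE => /eqP<-; apply: enum_valP.
have c'E i : c' (enum_val i) = c i.
  by apply: big_pred1 => j; rewrite (inj_eq enum_val_inj).
pose C (i j : 'I_n) := if (i < j)%N then c' [set i; j]
                       else if (j < i)%N then - c' [set i; j] else 0.
have CN a b : C b a = - C a b.
  by rewrite /C (setUC [set b]); case: ltngtP; rewrite ?oppr0 ?opprK.
have Z0 : \sum_(i : 'I_n) \sum_(j : 'I_n | (i < j)%N) c' [set i; j] *: arc_vec i j = 0.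
  rewrite -[RHS]sum0.
  transitivity (\sum_(e in E) c' e *: edge_vec e); last first.
    rewrite big_enum_val; apply: eq_bigr => i _.
    by rewrite c'E -tnth_nth tnth_mktuple.
  under [RHS]eq_bigr => e _.
    have -> : edge_vec e = \sum_(i : 'I_n) \sum_(j : 'I_n | (i < j)%N)
                ((i \in e) && (j \in e))%:R *: arc_vec i j.
      rewrite /edge_vec big_mkcond; apply: eq_bigr => i _.
      rewrite big_mkcondl /=; case: (i \in e); last first.
        by rewrite big1 // => j _; rewrite scale0r.
      by apply: eq_bigr => j _; case: (j \in e); rewrite ?scale1r ?scale0r.
    rewrite scaler_sumr.
    under eq_bigr => i _ do rewrite scaler_sumr.
    over.
  rewrite [RHS]exchange_big /=; apply: eq_bigr => i _.
  rewrite [RHS]exchange_big /=; apply: eq_bigr => j ij.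
  under eq_bigr => e _ do rewrite scalerA.
  rewrite -scaler_suml; congr (_ *: _).
  have unique e : e \in E -> (i \in e) && (j \in e) -> e = [set i; j].
    rewrite !inE => /andP[/eqP e2 _] ije; apply/eqP; rewrite eq_sym eqEcard.
    rewrite e2 cards2 -val_eqE neq_ltn ij andbT; apply/subsetP => x.
    by rewrite !inE => /orP[]/eqP->; case/andP: ije.
  have [ijE|ijE] := boolP ([set i; j] \in E).
    rewrite (bigD1 [set i; j]) //= !inE !eqxx orbT mulr1 big1 ?addr0 // => e.
    case/andP=> eE; case: (boolP (_ && _)) => [/(unique _ eE)->|]; last first.
      by rewrite mulr0.
    by rewrite eqxx.
  rewrite c'0 // big1 // => e eE.
  case: (boolP (_ && _)) => [/(unique _ eE) eij|]; last by rewrite mulr0.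
  by rewrite -eij eE in ijE.
(* The full double sum counts every pair twice. *)
have ZZ : \sum_i \sum_j C i j *: arc_vec i j = 0.
  transitivity (\sum_(i : 'I_n) \sum_(j : 'I_n | (i < j)%N) c' [set i; j] *: arc_vec i j
              + \sum_(i : 'I_n) \sum_(j : 'I_n | (i < j)%N) c' [set i; j] *: arc_vec i j).
    under [X in _ + X]eq_bigr => i _ do rewrite big_mkcond.
    rewrite [X in _ + X]exchange_big -big_split /=; apply: eq_bigr => i _.
    rewrite [X in X + _]big_mkcond -big_split /=; apply: eq_bigr => j _.
    rewrite /C (arc_vecC i j) (setUC [set j]).
    by case: ltngtP => _; rewrite ?addr0 ?add0r ?scaleNr ?scalerN ?scale0r.
  by rewrite Z0 addr0.
have C0 x (k : 'I_d) : \sum_a C a x * node a ^+ k = 0.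
  have := @sum_arc_vec _ id C x k CN; rewrite ZZ mxE => /esym/eqP.
  rewrite mulf_eq0 /= (bigD1 x) //= eqxx mul1r [X in _ + X]big1 ?addr0 => [/eqP//|b bx].
  by rewrite eq_sym (negPf bx) mul0r.
have d_ord := card_ord_ltn dn.
have Cge (x : 'I_n) : (d <= x)%N -> forall a, C a x = 0.
  move=> dx; apply: (moments_inj node_inj (A := [set i : 'I_n | (i < d)%N])).
    (* If [a] and [x] are both at least [d], then [[set a; x]] is no star edge. *)
    move=> a; rewrite inE -leqNgt => da; rewrite /C c'0 ?oppr0 ?if_same //.
    rewrite !inE negb_and; apply/orP; right; apply/existsPn => i.
    by rewrite !inE; apply/negP => /andP[/orP[]/eqP->]; lia.
  by move=> k; rewrite d_ord => kd; apply: (C0 x (Ordinal kd)).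
have Call x a : C a x = 0.
  have [/Cge//|xd] := leqP d x.
  move: a; apply: (moments_inj node_inj (A := [set i : 'I_n | (i < d)%N])).
    by move=> a; rewrite inE -leqNgt => da; rewrite CN Cge ?oppr0.
  by move=> k; rewrite d_ord => kd; apply: (C0 x (Ordinal kd)).
move=> i; rewrite -c'E; have := enum_valP i; rewrite inE => /andP[+ _].
rewrite inE => /cards2P[a [b [ab ->]]].
have := Call b a; rewrite /C; case: ltngtP => [//|_ /eqP|/val_inj/eqP].
  by rewrite oppr_eq0 => /eqP.
by rewrite (negPf ab).
Qed.
End EdgeVectors.

(** The last hypothesis puts the vectors of all pairs in the span of [G], saturation puts that span
    inside the span of [H], whose dimension is at most [#|H|], and the star edges are
    independent. *)
Lemma percolation_card_ge n d (G H : {set {set 'I_n}}) es :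
  (d <= n)%N ->
  saturating (complete_graph 'I_d.+2) H es ->
  (forall e, e \in G -> (e \in H) || (e \in es)) ->
  (forall e, e \in pairs 'I_n -> e \notin G ->
     creates_copy (complete_graph 'I_d.+2) G e) ->
  ('C(n, 2) <= #|H| + 'C(n - d, 2))%N.
Proof.
move=> dn satH GH satG; rewrite -(card_star_edges n d) leq_add2r.
apply: (leq_trans (star_edges_free dn)).
apply: (leq_trans _ (dim_edge_span d H)); apply: dimvS.
have sGH : (edge_span d G <= edge_span d H)%VS.
  apply: edge_span_sub => e /GH/orP[|]; first exact: edge_vec_span.
  exact: saturating_span.
apply: edge_span_sub => e; rewrite inE => /andP[eP _]; apply: (subvP sGH).
have [eG|eG] := boolP (e \in G); first exact: edge_vec_span.
by apply: creates_copy_span; apply: satG.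
Qed.

(** * Saturation and infection by cliques *)

Lemma saturating_exists (U T : finType) (F : sgraph U) (G H : {set {set T}}) :
  H \subset G ->
  (forall X : {set {set T}}, H \subset X -> X \subset G ->
     (forall e, e \in G -> e \notin X -> ~ creates_copy F X e) -> X = G) ->
  exists2 es, perm_eq es (enum (G :\: H)) & saturating F H es.
Proof.
(* Greedy induction on the number of missing edges: while [H] is not all of [G], [percH] yields an
   edge to add next, and it still holds for the larger set. *)
move: {2}#|G :\: H| (leqnn #|G :\: H|) => m.
elim: m H => [|m IH] H Hm HG percH.
  exists [::] => //; move: Hm; rewrite leqn0 cards_eq0 => /eqP->.
  by rewrite enum_set0.
have [GH|GH] := eqVneq (G :\: H) set0; first by exists [::]; rewrite ?GH ?enum_set0.
have [e [eG eH eF]] : exists e, [/\ e \in G, e \notin H & creates_copy F H e].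
  have [//|none] := boolp.pselect (exists e, [/\ e \in G, e \notin H & creates_copy F H e]).
  have E : H = G by apply: percH => // e eG eH eF; apply: none; exists e.
  by rewrite E setDv eqxx in GH.
have GHe : G :\: H = e |: (G :\: (e |: H)).
  apply/setP => h; rewrite !inE; case: eqVneq => [->|] //=.
  by rewrite eG eH.
have [||X|es pes ses] := IH (e |: H).
- by move: Hm; rewrite GHe cardsU1 !inE eqxx.
- by rewrite subUset sub1set eG.
- by rewrite subUset => /andP[_]; apply: percH.
exists (e :: es) => //.
apply: uniq_perm; rewrite ?enum_uniq //=.
  by rewrite (perm_uniq pes) enum_uniq (perm_mem pes) mem_enum !inE eqxx.
move=> x; rewrite inE (perm_mem pes) !mem_enum GHe !inE.
by case: eqVneq.
Qed.

Section Cliques.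
Variables (T : finType) (d : nat).
Implicit Types (G H X : {set {set T}}) (P Q R S W Y Z : {set T}).

Lemma clique_is_copy W : #|W| = d.+2 ->
  is_copy (complete_graph 'I_d.+2) [set e in pairs T | e \subset W].
Proof.
move=> cW; pose f (i : 'I_d.+2) := enum_val (cast_ord (esym cW) i).
have f_inj : injective f by move=> i j /enum_val_inj/cast_ord_inj.
exists f => //; apply/setP => e; rewrite !inE; apply/andP/imsetP.
  case=> /eqP e2 /subsetP eW; have fe : f @: (f @^-1: e) = e.
    apply/setP => x; apply/imsetP/idP => [[i + ->]|xe]; first by rewrite inE.
    exists (cast_ord cW (enum_rank_in (eW x xe) x)).
      by rewrite inE /f cast_ordK enum_rankK_in ?eW.
    by rewrite /f cast_ordK enum_rankK_in ?eW.
  by exists (f @^-1: e); rewrite // inE -(card_imset _ f_inj) fe e2.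
case=> e' + ->; rewrite inE => e'2; rewrite card_imset //; split => //.
by apply/subsetP => _ /imsetP[i _ ->]; apply: enum_valP.
Qed.

(** Pairs inside [S] are left out, so that disjoint choices of [R] away from [S] give disjoint edge
    sets, hence independent events. *)
Definition join_edges R S : {set {set T}} :=
  [set e in pairs T | (e \subset R :|: S) && ~~ [disjoint R & e]].

Lemma join_edgesP R S X : [disjoint R & S] ->
  reflect ({in R &, forall a b, a != b -> [set a; b] \in X} /\
           {in R & S, forall a b, [set a; b] \in X})
          (join_edges R S \subset X).
Proof.
move=> dRS; apply: (iffP subsetP) => [sub|[subR subS] e].
  split=> a b aR bS; [move=> ab|have ab : a != b].
  - apply: sub; rewrite !inE cards2 ab subUset !sub1set !inE aR bS /=.
    by apply/negP => /pred0P/(_ a)/=; rewrite !inE aR eqxx.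
  - by apply: contraTneq bS => <-; rewrite (disjointFr dRS).
  apply: sub; rewrite !inE cards2 ab subUset !sub1set !inE aR bS orbT /=.
  by apply/negP => /pred0P/(_ a)/=; rewrite !inE aR eqxx.
rewrite !inE => /and3P[/cards2P[a [b [ab ->]]]].
rewrite subUset !sub1set !inE => /andP[aRS bRS] /pred0Pn[c /=].
rewrite !inE => /andP[cR /orP[]/eqP cE]; subst c.
  by case/orP: bRS => ?; [apply: subR|apply: subS].
rewrite setUC; case/orP: aRS => ?; [apply: subR|apply: subS] => //.
by rewrite eq_sym.
Qed.

Lemma join_creates_copy X Q u v :
  #|Q| = d -> [disjoint Q & [set u; v]] -> u != v -> [set u; v] \notin X ->
  join_edges Q [set u; v] \subset X ->
  creates_copy (complete_graph 'I_d.+2) X [set u; v].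
Proof.
move=> cQ dQ uv uvX subX; set W := Q :|: [set u; v].
have cW : #|W| = d.+2 by rewrite cardsU (disjoint_setI0 dQ) cards0 cQ cards2 uv subn0 addn2.
exists [set e in pairs T | e \subset W]; split; first exact: clique_is_copy.
  apply/subsetP => e; rewrite inE => /andP[eP eW]; rewrite in_setU1.
  have [eQ|eQ] := boolP [disjoint Q & e]; last first.
    by rewrite (subsetP subX) ?orbT // inE eP eW.
  rewrite eqEcard cards2 uv; move: (eP); rewrite inE => /eqP->; rewrite andbT.
  apply/orP; left; apply/subsetP => x xe; have := subsetP eW x xe.
  by rewrite inE (disjointFl eQ xe).
apply/subsetPn; exists [set u; v] => //.
by rewrite !inE cards2 uv subsetUr.
Qed.

(** Sets of size [d + 2] occur in [infect_core], as a [d]-clique together with an edge. *)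
Definition absorbing G Z Y :=
  forall S, S \subset Y -> (0 < #|S| <= d.+2)%N ->
  exists R, [/\ R \subset Z, #|R| = d, [disjoint R & S] & join_edges R S \subset G].

Section Percolation.
Variables (G X : {set {set T}}).
Hypothesis GP : G \subset pairs T.
Hypothesis Xclosed : forall e, e \in G -> e \notin X ->
  ~ creates_copy (complete_graph 'I_d.+2) X e.

Lemma edge_neq u v : [set u; v] \in G -> u != v.
Proof. by move=> /(subsetP GP); rewrite inE cards2; case: (u != v). Qed.

(** Otherwise [Q] with [u] and [v] would be a clique lacking only the edge [uv] in [X], against the
    closure of [X]. *)
Lemma infect Q u v : #|Q| = d -> [set u; v] \in G ->
  {in Q &, forall a b, a != b -> [set a; b] \in X} ->
  u \notin Q -> v \notin Q ->
  (forall a, a \in Q -> [set a; u] \in X) ->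
  (forall a, a \in Q -> [set a; v] \in X) ->
  [set u; v] \in X.
Proof.
move=> cQ uvG QX uQ vQ uX vX.
have [//|uvX] := boolP ([set u; v] \in X); case: (Xclosed uvG uvX).
have dQ : [disjoint Q & [set u; v]].
  by rewrite disjoint_sym disjoints_subset subUset !sub1set !inE uQ vQ.
apply: (join_creates_copy cQ) => //; first exact: edge_neq.
apply/join_edgesP => //; split=> // a b aQ.
by rewrite !inE => /orP[]/eqP->; [apply: uX|apply: vX].
Qed.

(** Take a clique [R] in [Z] joined to [P], [v] and [w]. First [P] infects the edges from [R] to
    [v], then [R] infects [vw]; the other edges involved lie inside [Z] or join [P] to [v]. *)
Lemma infect_core Y Z P v w : Z \subset Y -> absorbing G Z Y ->
  {in Z &, forall a b, [set a; b] \in G -> [set a; b] \in X} ->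
  v \in Y -> v \notin P -> #|P| = d -> P \subset Z ->
  {in P &, forall a b, a != b -> [set a; b] \in G} ->
  (forall a, a \in P -> [set a; v] \in X) ->
  w \in Z -> [set v; w] \in G -> [set v; w] \in X.
Proof.
move=> /subsetP ZY abZ ZX vY vP cP PZ PG PvX wZ vwG.
have [||R [RZ cR dR]] := abZ (P :|: [set v; w]).
- apply/subsetP => a; rewrite !inE.
  by move=> /or3P[/(subsetP PZ)/ZY|/eqP->|/eqP->] //; apply: ZY.
- rewrite card_gt0 -cP -addn2 (leq_trans (leq_card_setU _ _)) ?leq_add2l ?cards2.
    by rewrite andbT; apply/set0Pn; exists v; rewrite !inE eqxx orbT.
  by case: (_ != _).
move/join_edgesP => /(_ dR)[RG RSG].
have RS a : a \in R -> [/\ a \notin P, a != v & a != w].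
  by move=> /(disjointFr dR); rewrite !inE => /negbT; rewrite !negb_or => /and3P[].
have /subsetP RZ' := RZ; have /subsetP PZ' := PZ.
have RvX a : a \in R -> [set a; v] \in X.
  move=> aR; have [aP av aw] := RS a aR.
  apply: (infect cP) => //.
  - by apply: RSG; rewrite // !inE eqxx orbT.
  - by move=> b c bP cP' bc; apply: ZX; rewrite ?PZ' // PG.
  - move=> b bP; apply: ZX; [exact: PZ'|exact: RZ'|].
    by rewrite setUC; apply: RSG; rewrite // !inE bP.
apply: (infect cR) => //.
- by move=> b c bR cR' bc; apply: ZX; rewrite ?RZ' // RG.
- by apply/negP => /RS[_ /eqP].
- by apply/negP => /RS[_ _ /eqP].
- move=> a aR; apply: ZX; [exact: RZ'|by []|].
  by apply: RSG; rewrite // !inE eqxx !orbT.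
Qed.

(** A clique of [Z] joined to both [a] and [b] has all the edges concerned in [X] already, and so
    infects [ab]. *)
Lemma infect_pairs Y Z : Z \subset Y -> absorbing G Z Y ->
  (forall v w, v \in Y -> w \in Z -> [set v; w] \in G -> [set v; w] \in X) ->
  {in Y &, forall a b, [set a; b] \in G -> [set a; b] \in X}.
Proof.
move=> /subsetP ZY abZ YZX a b aY bY abG.
have [||R [/subsetP RZ cR dR]] := abZ [set a; b].
- by rewrite subUset !sub1set aY.
- by rewrite cards2; case: (_ != _).
move/join_edgesP => /(_ dR)[RG RSG].
apply: (infect cR) => //.
- by move=> u v uR vR uv; apply: YZX; rewrite ?ZY ?RZ // RG.
- by apply/negP => /(disjointFr dR); rewrite !inE eqxx.
- by apply/negP => /(disjointFr dR); rewrite !inE eqxx orbT.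
- move=> c cR'; rewrite setUC; apply: YZX; rewrite ?RZ // setUC.
  by apply: RSG; rewrite // !inE eqxx.
- move=> c cR'; rewrite setUC; apply: YZX; rewrite ?RZ // setUC.
  by apply: RSG; rewrite // !inE eqxx orbT.
Qed.

End Percolation.

(* Every vertex outside [Q] is joined in [H] to a [d]-clique of the preceding
   layer of the chain [Q], [Z1], [Z], [T]. *)
Lemma percolating_exists G Q Z1 Z :
  G \subset pairs T -> #|Q| = d -> [disjoint Q & Z] -> Z1 \subset Z ->
  join_edges Q Z1 \subset G -> absorbing G Z1 Z -> absorbing G Z setT ->
  exists2 H : {set {set T}}, H \subset G /\ (#|H| <= 'C(d, 2) + (#|T| - d) * d)%N &
    forall X, H \subset X -> X \subset G ->
    (forall e, e \in G -> e \notin X ->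
       ~ creates_copy (complete_graph 'I_d.+2) X e) -> X = G.
Proof.
move=> GP cQ dQZ Z1Z QZ1 ab1 ab.
have dQZ1 : [disjoint Q & Z1] by apply: disjointWr Z1Z dQZ.
have [QG QZ1G] := join_edgesP _ dQZ1 QZ1.
have exK v : exists K : {set T}, v \notin Q ->
    [/\ #|K| = d, v \notin K, {in K &, forall a b, a != b -> [set a; b] \in G},
        forall a, a \in K -> [set a; v] \in G &
        if v \in Z1 then K = Q else if v \in Z then K \subset Z1 else K \subset Z].
  have step Z' Y : absorbing G Z' Y -> v \in Y -> exists K : {set T},
      [/\ #|K| = d, v \notin K, {in K &, forall a b, a != b -> [set a; b] \in G},
          forall a, a \in K -> [set a; v] \in G & K \subset Z'].
    move=> abs vY; have [||K [KZ cK dK]] := abs [set v].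
    - by rewrite sub1set.
    - by rewrite cards1.
    move/join_edgesP => /(_ dK)[KG KvG]; exists K; split=> //.
      by rewrite -disjoints1 disjoint_sym.
    by move=> a aK; apply: KvG; rewrite ?inE.
  case: (boolP (v \in Z1)) => vZ1; first exists Q.
    by move=> vQ; split=> // a aQ; apply: QZ1G.
  case: (boolP (v \in Z)) => vZ.
    by have [K HK] := step _ _ ab1 vZ; exists K.
  by have [K HK] := step _ _ ab (in_setT v); exists K.
have [K HK] := fin_all_exists exK.
pose H := [set e in pairs T | e \subset Q] :|:
          \bigcup_(v in ~: Q) [set [set a; v] | a in K v].
have QH a b : a \in Q -> b \in Q -> a != b -> [set a; b] \in H.
  by move=> aQ bQ ab'; rewrite !inE cards2 ab' subUset !sub1set aQ bQ.
have KH a v : v \notin Q -> a \in K v -> [set a; v] \in H.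
  move=> vQ aK; rewrite inE; apply/orP; right.
  by apply/bigcupP; exists v; rewrite ?inE //; apply: imset_f.
exists H; first split.
- rewrite subUset; apply/andP; split.
    apply/subsetP => e; rewrite !inE => /andP[/cards2P[a [b [ab' ->]]]].
    by rewrite subUset !sub1set => /andP[aQ bQ]; apply: QG.
  apply/bigcupsP => v; rewrite inE => vQ; apply/subsetP => _ /imsetP[a aK ->].
  by have [_ _ _ KG _] := HK v vQ; apply: KG.
- apply: (leq_trans (leq_card_setU _ _)); apply: leq_add.
    rewrite -cQ -cards_draws subset_leq_card //; apply/subsetP => e.
    by rewrite !inE andbC.
  apply: (@leq_trans (\sum_(v in ~: Q) #|[set [set a; v] | a in K v]|)).
    apply: (big_ind2 (fun (A : {set {set T}}) m => (#|A| <= m)%N)).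
    + by rewrite cards0.
    + move=> A m B m' Am Bm; apply: (leq_trans (leq_card_setU _ _)).
      exact: leq_add.
    + by [].
  have -> : (#|T| - d = #|~: Q|)%N by rewrite [RHS]cardsCs setCK cQ.
  rewrite -sum_nat_const; apply: leq_sum => v; rewrite inE => vQ.
  have [<- _ _ _ _] := HK v vQ; exact: leq_imset_card.
move=> X /subsetP HX XG Xclosed; apply/eqP; rewrite eqEsubset XG /=.
have QX a b : a \in Q -> b \in Q -> a != b -> [set a; b] \in X.
  by move=> aQ bQ ab'; apply/HX/QH.
have KX a v : v \notin Q -> a \in K v -> [set a; v] \in X.
  by move=> vQ aK; apply/HX/KH.
have ZQ v : v \in Z -> v \notin Q by move=> vZ; rewrite (disjointFl dQZ vZ).
have /subsetP Z1Z' := Z1Z.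
(* In [H] all of [Z1] is joined to [Q], which infects the edges inside [Z1]. *)
have Z1X : {in Z1 &, forall a b, [set a; b] \in G -> [set a; b] \in X}.
  move=> a b aZ bZ abG; apply: (infect GP Xclosed cQ); rewrite ?ZQ ?Z1Z' //.
    have /HK[_ _ _ _] : a \notin Q by rewrite ZQ ?Z1Z'.
    by rewrite aZ => KQ c cQ'; apply: KX; rewrite ?KQ ?ZQ ?Z1Z'.
  have /HK[_ _ _ _] : b \notin Q by rewrite ZQ ?Z1Z'.
  by rewrite bZ => KQ c cQ'; apply: KX; rewrite ?KQ ?ZQ ?Z1Z'.
have ZZ1X v w : v \in Z -> w \in Z1 -> [set v; w] \in G -> [set v; w] \in X.
  move=> vZ wZ1; have [vZ1|vZ1] := boolP (v \in Z1); first exact: Z1X.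
  have [cK vK KG _] := HK v (ZQ v vZ); rewrite (negPf vZ1) vZ => KZ1.
  apply: (infect_core GP Xclosed (P := K v) Z1Z) => // a aK.
  by apply: KX => //; apply: ZQ.
have ZX := infect_pairs GP Xclosed Z1Z ab1 ZZ1X.
have TZX v w : v \in setT -> w \in Z -> [set v; w] \in G -> [set v; w] \in X.
  move=> _ wZ; have [vZ|vZ] := boolP (v \in Z); first exact: ZX.
  have [vQ|vQ] := boolP (v \in Q); last first.
    have vZ1 : v \notin Z1 by apply: contra vZ; apply: Z1Z'.
    have [cK vK KG _] := HK v vQ; rewrite (negPf vZ1) (negPf vZ) => KZ.
    apply: (infect_core GP Xclosed (P := K v) (subsetT Z)) => // a aK.
    exact: KX.
  (* No clique [K v] is available for [v] in [Q], but all pairs from [v] to [Z1] are in [H]; a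
     clique of [Z1] joined to [w] then infects [vw]. *)
  have vZ1X a : a \in Z1 -> [set a; v] \in X.
    move=> aZ1; have /HK[_ _ _ _] : a \notin Q by rewrite ZQ ?Z1Z'.
    by rewrite aZ1 => KQ; rewrite setUC; apply: KX; rewrite ?KQ ?ZQ ?Z1Z'.
  move=> vwG.
  have [||R [/subsetP RZ cR dR]] := ab1 [set w].
  - by rewrite sub1set.
  - by rewrite cards1.
  move/join_edgesP => /(_ dR)[RG RSG].
  apply: (infect GP Xclosed cR) => //.
  + by move=> a b aR bR ab'; apply: Z1X; rewrite ?RZ // RG.
  + by apply: contra vZ => /RZ/Z1Z'.
  + by rewrite -disjoints1 disjoint_sym.
  + by move=> a /RZ; apply: vZ1X.
  + move=> a aR; apply: ZX; [exact/Z1Z'/RZ|by []|].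
    by apply: RSG; rewrite ?inE.
apply/subsetP => e eG; have := subsetP GP e eG; rewrite inE => /cards2P[a [b [_ eE]]].
by rewrite eE; apply: (infect_pairs GP Xclosed (subsetT Z)); rewrite // -eE.
Qed.

End Cliques.

(** * The exact value on graphs with the layered structure *)

Lemma bin2D d m : 'C(d + m, 2) = ('C(d, 2) + m * d + 'C(m, 2))%N.
Proof.
elim: m => [|m IH]; first by rewrite addn0 bin0n !addn0.
by rewrite addnS !binS !bin1 IH; lia.
Qed.

(** [percolation_card_ge] and [percolating_exists] give matching bounds, and their tightness also
    forces the constructed [H] to be copy-free. *)
Lemma wsat_cliqueE n d (G : sgraph 'I_n) (Q Z1 Z : {set 'I_n}) :
  #|Q| = d -> [disjoint Q & Z] -> Z1 \subset Z ->
  join_edges Q Z1 \subset edges G ->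
  absorbing d (edges G) Z1 Z -> absorbing d (edges G) Z setT ->
  (wsat (complete_graph 'I_d.+2) G + 'C(n - d, 2) = 'C(n, 2))%N.
Proof.
move=> cQ dQZ Z1Z QZ1 ab1 ab.
have dn : (d <= n)%N by rewrite -cQ (leq_trans (max_card _)) ?card_ord.
have satG e : e \in pairs 'I_n -> e \notin edges G ->
    creates_copy (complete_graph 'I_d.+2) (edges G) e.
  rewrite inE => /cards2P[u [v [uv ->]]] uvG.
  have [|R [_ cR dR RG]] := ab [set u; v] (subsetT _).
    by rewrite cards2 uv.
  exact: (join_creates_copy cR).
have lower (H : {set {set 'I_n}}) es : perm_eq es (enum (edges G :\: H)) ->
    saturating (complete_graph 'I_d.+2) H es -> ('C(n, 2) <= #|H| + 'C(n - d, 2))%N.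
  move=> pes ses; apply: (percolation_card_ge dn ses) satG => e eG.
  by rewrite (perm_mem pes) mem_enum inE eG; case: (e \in H).
have K0 : edges (complete_graph 'I_d.+2) != set0.
  by apply/set0Pn; exists [set ord0; ord_max]; rewrite inE cards2.
have [H0 [[_ _ [es pes ses]] cH0] minH] := wsat_spec G K0.
apply/eqP; rewrite eqn_leq -{2}cH0 (lower _ _ pes ses) andbT.
have [H [HG cH] percH] := percolating_exists (edges_pairs G) cQ dQZ Z1Z QZ1 ab1 ab.
have {}cH : (#|H| + 'C(n - d, 2) <= 'C(n, 2))%N.
  by rewrite -[in X in (_ <= X)%N](subnKC dn) bin2D leq_add2r; rewrite card_ord in cH.
apply: leq_trans (cH); rewrite leq_add2r.
have HP := subset_trans HG (edges_pairs G).
have [es' pes' ses'] := saturating_exists HG percH.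
apply: (minH (SGraph HP)); split; [by []| |by exists es'].
move=> C copyC; apply/negP => CH.
have [e eC] : exists e, e \in C.
  have [e eF] := set0Pn _ K0; case: copyC => f _ ->.
  by exists (f @: e); apply: imset_f.
have eH : e \in H by apply: (subsetP CH).
(* An edge of a copy inside [H] could be removed and added back first, giving a saturating start
   below the lower bound. *)
have : ('C(n, 2) <= #|H :\ e| + 'C(n - d, 2))%N.
  apply: (lower _ (e :: es')).
    apply: uniq_perm; rewrite ?enum_uniq //=.
      by rewrite (perm_uniq pes') enum_uniq (perm_mem pes') mem_enum !inE eH.
    move=> x; rewrite inE (perm_mem pes') !mem_enum !inE.
    by case: eqP => [->|_] //=; rewrite (subsetP HG).
  split; last by rewrite setD1K.
  exists C; rewrite setD1K //; split => //.
  by apply/subsetPn; exists e; rewrite // !inE eqxx.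
by rewrite leqNgt (leq_trans _ cH) // (cardsD1 e H) eH.
Qed.

(** * Probability estimates for [G(n, p)] *)

Section RandomGraph.
Variables (R : realType) (n : nat) (p : R).
Implicit Types (A B : pred (sgraph 'I_n)) (D : {set {set 'I_n}}).

(** By distributivity the sum over edge sets becomes a product: a pair of [D] contributes [p + 0],
    any other pair [p + (1 - p)], and a set that is not a pair [0 + 1]. *)
Lemma gnp_prob_sub D : D \subset pairs 'I_n ->
  gnp_prob p [pred G : sgraph 'I_n | D \subset edges G] = p ^+ #|D|.
Proof.
move=> DP.
have -> : gnp_prob p [pred G : sgraph 'I_n | D \subset edges G] =
    \sum_(E : {set {set 'I_n}} | (E \subset pairs 'I_n) && (D \subset E))
    \prod_(e in pairs 'I_n) (if e \in E then p else 1 - p).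
  rewrite (reindex_omap (@edges 'I_n) insub); last first.
    by move=> E /andP[EP _]; rewrite insubT.
  by apply: eq_bigl => G; rewrite valK eqxx andbT edges_pairs.
transitivity (\prod_(e : {set 'I_n}) ((if e \in pairs 'I_n then p else 0) +
    (if e \in D then 0 else if e \in pairs 'I_n then 1 - p else 1))).
  rewrite bigA_distr [RHS](bigID (fun E : {set {set 'I_n}} =>
    (E \subset pairs 'I_n) && (D \subset E))) /=.
  rewrite [X in _ = _ + X]big1 ?addr0 => [|E]; last first.
    rewrite negb_and => /orP[] /subsetPn[e eE /negPf eP].
      by rewrite (bigD1 e) //= eE eP mul0r.
    by rewrite (bigD1 e) //= eE eP mul0r.
  apply: eq_big => // E /andP[EP DE]; rewrite big_mkcond /=; apply: eq_bigr => e _.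
  case: ifPn => eP.
    by case: ifPn => // eE; rewrite ifN //; apply: contra eE; apply: (subsetP DE).
  rewrite [e \in E](contraNF (subsetP EP e)) // ifN //.
  by apply: contra eP; apply: (subsetP DP).
rewrite (bigID [in D]) /= [X in _ * X]big1 ?mulr1 => [|e /negPf->]; last first.
  by case: ifP => _; rewrite ?add0r // addrC subrK.
rewrite -prodr_const; apply: eq_bigr => e eD.
by rewrite eD (subsetP DP) ?addr0.
Qed.

Lemma eq_gnp_prob A B : A =1 B -> gnp_prob p A = gnp_prob p B.
Proof. by move=> AB; apply: eq_bigl. Qed.

(** Induction, splitting on whether the next set lies in [G]; if it does, it is merged into [D0],
    which is carried along for that purpose. *)
Lemma gnp_prob_avoid D0 (Ds : seq {set {set 'I_n}}) :
  all (fun D => D \subset pairs 'I_n) (D0 :: Ds) ->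
  pairwise (fun D D' => [disjoint D & D']) (D0 :: Ds) ->
  gnp_prob p [pred G : sgraph 'I_n | (D0 \subset edges G) &&
                all (fun D => ~~ (D \subset edges G)) Ds]
  = p ^+ #|D0| * \prod_(D <- Ds) (1 - p ^+ #|D|).
Proof.
elim: Ds D0 => [|D Ds IH] D0.
  rewrite /= !andbT => DP _; rewrite big_nil mulr1 -gnp_prob_sub //.
  by apply: eq_gnp_prob => G; rewrite /= andbT.
rewrite /= -!andbA => /and3P[D0P DP DsP] /and4P[dD0 dD0s dDs pDs].
have split : gnp_prob p [pred G : sgraph 'I_n | (D0 \subset edges G) &&
      all (fun D => ~~ (D \subset edges G)) Ds] =
    gnp_prob p [pred G : sgraph 'I_n | ((D0 :|: D) \subset edges G) &&
      all (fun D => ~~ (D \subset edges G)) Ds] +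
    gnp_prob p [pred G : sgraph 'I_n | (D0 \subset edges G) &&
      all (fun D => ~~ (D \subset edges G)) (D :: Ds)].
  rewrite /gnp_prob (bigID (fun G : sgraph 'I_n => D \subset edges G)) /=.
  congr (_ + _); apply: eq_bigl => G /=; rewrite ?subUset.
    by rewrite andbAC.
  by rewrite -andbA [in RHS](andbC (~~ _)).
move: split; rewrite (IH D0) /= ?D0P ?DsP ?dD0s ?pDs //.
rewrite (IH (D0 :|: D)) /= ?subUset ?D0P ?DP ?DsP ?pDs ?andbT //; last first.
  apply/allP => D' D's.
  have := allP dD0s D' D's; have := allP dDs D' D's.
  by rewrite -!setI_eq0 setIUl => /eqP-> /eqP->; rewrite setU0 eqxx.
rewrite cardsU (disjoint_setI0 dD0) cards0 subn0 exprD big_cons.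
move=> /(canLR (addKr _)) <-.
move: (p ^+ #|D0|) (p ^+ #|D|) (\prod_(_ <- _) _) => a b c; ring.
Qed.

Hypotheses (p_ge0 : 0 <= p) (p_le1 : p <= 1).

Lemma gnp_mass_ge0 (G : sgraph 'I_n) : 0 <= gnp_mass p G.
Proof. by apply: prodr_ge0 => e _; case: ifP; rewrite // subr_ge0. Qed.

Lemma le_gnp_prob A B : (forall G, A G -> B G) -> gnp_prob p A <= gnp_prob p B.
Proof.
move=> AB; rewrite /gnp_prob [leLHS]big_mkcond [leRHS]big_mkcond /=.
apply: ler_sum => G _; have := gnp_mass_ge0 G.
by case: ifPn => [/AB->//|_]; case: ifP.
Qed.

Lemma gnp_probC A : gnp_prob p A = 1 - gnp_prob p (predC A).
Proof.
apply/eqP; rewrite eq_sym subr_eq -(gnp_prob_total n p) /gnp_prob.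
by rewrite [X in X == _](bigID A).
Qed.

Lemma gnp_probU A B : gnp_prob p (predU A B) <= gnp_prob p A + gnp_prob p B.
Proof.
rewrite /gnp_prob [leLHS]big_mkcond [X in _ <= X + _]big_mkcond.
rewrite [X in _ <= _ + X]big_mkcond -big_split /=.
apply: ler_sum => G _; have := gnp_mass_ge0 G.
by case: (A G); case: (B G) => //= G0; rewrite ?addr0 ?add0r // lerDl.
Qed.

Lemma gnp_prob_exists (I : finType) (P : pred I) (A : I -> pred (sgraph 'I_n)) :
  gnp_prob p [pred G | [exists i in P, A i G]] <= \sum_(i in P) gnp_prob p (A i).
Proof.
rewrite /gnp_prob; under [leRHS]eq_bigr => i _ do rewrite big_mkcond.
rewrite exchange_big [leLHS]big_mkcond /=; apply: ler_sum => G _.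
have term_ge0 i : 0 <= if A i G then gnp_mass p G else 0.
  by case: ifP; rewrite ?gnp_mass_ge0.
case: ifPn => [/existsP[i /andP[iP AiG]]|_]; last by apply: sumr_ge0.
by rewrite (bigD1 i) //= AiG lerDl; apply: sumr_ge0.
Qed.

Lemma gnp_prob_avoid_le (Ds : seq {set {set 'I_n}}) c :
  all (fun D => (D \subset pairs 'I_n) && (#|D| <= c)%N) Ds ->
  pairwise (fun D D' => [disjoint D & D']) Ds ->
  gnp_prob p [pred G : sgraph 'I_n | all (fun D => ~~ (D \subset edges G)) Ds]
  <= (1 - p ^+ c) ^+ size Ds.
Proof.
rewrite all_predI => /andP[DP Dc] dDs.
have := @gnp_prob_avoid set0 Ds; rewrite /= sub0set DP dDs andbT.
have -> : all (fun D' => [disjoint set0 & D']) Ds.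
  by apply/allP => D _; rewrite -setI_eq0 set0I.
move=> /(_ isT isT); rewrite cards0 expr0 mul1r.
under eq_gnp_prob => G do rewrite /= sub0set.
move=> ->; elim: Ds Dc {DP dDs} => [|D Ds IH] /=; first by rewrite big_nil.
move=> /andP[cD /IH{}IH]; rewrite big_cons exprS ler_pM // ?subr_ge0.
- by rewrite exprn_ile1.
- by apply: prodr_ge0 => D' _; rewrite subr_ge0 exprn_ile1.
- by rewrite lerD2l lerN2 ler_wiXn2l.
Qed.

End RandomGraph.

(** * Blocks of vertices as candidate cliques *)

Section Blocks.
Variables (n d : nat).
Hypothesis d_gt0 : (0 < d)%N.
Implicit Types (S Y : {set 'I_n}) (j M : nat).

(** Only blocks of [d] consecutive vertices are tried as cliques: being disjoint, they give
    independent events. *)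
Definition block j := [set i : 'I_n | (i %/ d == j)%N].

Definition initial_blocks M := [set i : 'I_n | (i %/ d < M)%N].

Lemma card_initial_blocks M : (M * d <= n)%N -> #|initial_blocks M| = (M * d)%N.
Proof.
move=> Mn; rewrite -[RHS](card_ord_ltn Mn).
by apply: eq_card => i; rewrite !inE ltn_divLR.
Qed.

Lemma card_block j : (j.+1 * d <= n)%N -> #|block j| = d.
Proof.
move=> jn; have jn' : (j * d <= n)%N by rewrite (leq_trans _ jn) ?leq_mul.
have -> : block j = initial_blocks j.+1 :\: initial_blocks j.
  by apply/setP => i; rewrite !inE ltnS -leqNgt eqn_leq andbC.
rewrite cardsD (setIidPr _) ?card_initial_blocks //; first by rewrite mulSn addnK.
by apply/subsetP => i; rewrite !inE => /leqW.
Qed.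

Lemma disjoint_blockP j S :
  reflect (forall i, i \in S -> (i %/ d != j)%N) [disjoint block j & S].
Proof.
apply: (iffP pred0P) => [dj i iS|dj i]; last first.
  by rewrite /= inE; case: eqP => //= /eqP; apply/contraTF/dj.
by have := dj i; rewrite /= inE iS andbT => ->.
Qed.

Lemma card_join_edges (R S : {set 'I_n}) :
  (#|join_edges R S| <= (#|R| + #|S|) ^ 2)%N.
Proof.
apply: (@leq_trans 'C(#|R :|: S|, 2)).
  rewrite -cards_draws subset_leq_card //; apply/subsetP => e.
  by rewrite !inE => /and3P[-> -> _].
have := leq_card_setU R S; move: #|R :|: S| (_ + _)%N => a b ab.
by rewrite bin2 (leq_trans (half_leq (leq_mul ab (leq_trans (leq_pred _) ab)))) //
  -divn2 leq_div.
Qed.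

Variables (R : realType) (p : R).
Hypotheses (p_ge0 : 0 <= p) (p_le1 : p <= 1).

(** A join edge of one block meets that block, while those of another block stay inside it and [S];
    so the edge sets are disjoint and [gnp_prob_avoid_le] applies. *)
Lemma gnp_prob_no_join_block (js : seq nat) S :
  uniq js ->
  {in js, forall j, (j.+1 * d <= n)%N /\ [disjoint block j & S]} ->
  gnp_prob p [pred G : sgraph 'I_n |
    all (fun j => ~~ (join_edges (block j) S \subset edges G)) js]
  <= (1 - p ^+ ((d + #|S|) ^ 2)) ^+ size js.
Proof.
move=> js_uniq jsP.
have := @gnp_prob_avoid_le R n p p_ge0 p_le1
  [seq join_edges (block j) S | j <- js] ((d + #|S|) ^ 2).
rewrite size_map => bound; apply: le_trans (bound _ _).
- by apply: le_gnp_prob => // G /=; rewrite all_map.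
- rewrite all_map; apply/allP => j /jsP[jn _] /=; apply/andP; split.
    by apply/subsetP => e; rewrite inE => /andP[].
  by rewrite -(card_block jn) card_join_edges.
elim: js js_uniq jsP {bound} => //= j js IH /andP[jjs js_uniq] jsP.
rewrite IH ?andbT // => [|k kjs]; last by apply: jsP; rewrite inE kjs orbT.
rewrite all_map; apply/allP => k kjs /=.
have [_ dk] : (k.+1 * d <= n)%N /\ [disjoint block k & S].
  by apply: jsP; rewrite inE kjs orbT.
apply/pred0P => e; apply/negP; rewrite /= !inE.
move=> /andP[/and3P[_ /subsetP esub _] /and3P[_ _ /pred0Pn[i /andP[ik ie]]]].
have := esub i ie; rewrite inE (disjointFr dk ik) orbF.
by move: ik; rewrite !inE => /eqP-> /eqP kj; rewrite -kj kjs in jjs.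
Qed.

(** The functions [g] enumerate, with repetitions, the nonempty sets of at most [d + 2] vertices of
    [Y], so a union bound costs a factor [#|Y| ^ d.+2]. *)
Definition absorbs M Y (G : sgraph 'I_n) :=
  [forall g : {ffun 'I_d.+2 -> 'I_n}, (g \in ffun_on (mem Y)) ==>
     has (fun j => [disjoint block j & codom g] &&
                   (join_edges (block j) [set x in codom g] \subset edges G))
         (iota 0 M)].

Lemma absorbsP M Y (G : sgraph 'I_n) : (M * d <= n)%N ->
  absorbs M Y G -> absorbing d (edges G) (initial_blocks M) Y.
Proof.
move=> Mn /forallP abs S SY /andP[S0 Sd].
have [x0 x0S] : exists x, x \in S by apply/set0Pn; rewrite -card_gt0.
pose g := [ffun i : 'I_d.+2 => nth x0 (enum S) i].
have gS i : g i \in S.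
  rewrite ffunE; have [iS|iS] := ltnP i (size (enum S)).
    by rewrite -mem_enum mem_nth.
  by rewrite nth_default.
have gE : codom g =i S.
  move=> x; apply/codomP/idP => [[i ->]//|xS].
  have xs : (index x (enum S) < d.+2)%N.
    by rewrite (leq_trans _ Sd) // cardE index_mem mem_enum.
  by exists (Ordinal xs); rewrite ffunE /= nth_index ?mem_enum.
have /implyP/(_ _)/hasP[|j] := abs g.
  by apply/ffun_onP => i; apply: (subsetP SY).
rewrite mem_iota /= => jM /andP[dj jG].
exists (block j); split.
- by apply/subsetP => i; rewrite !inE => /eqP->.
- by rewrite card_block // (leq_trans _ Mn) // leq_mul2r jM orbT.
- by rewrite (eq_disjoint_r gE) in dj.
by rewrite (_ : [set x in codom g] = S) // in jG; apply/setP => x; rewrite inE gE.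
Qed.

(** Union bound over [g]: at most [d + 2] blocks meet its image, and the others fail
    independently. *)
Lemma gnp_prob_absorbs M Y : (M * d <= n)%N ->
  gnp_prob p [pred G | ~~ absorbs M Y G] <=
  (#|Y| ^ d.+2)%:R * (1 - p ^+ ((d + d.+2) ^ 2)) ^+ (M - d.+2).
Proof.
move=> Mn.
pose fails (g : {ffun 'I_d.+2 -> 'I_n}) : pred (sgraph 'I_n) := fun G =>
  ~~ has (fun j => [disjoint block j & codom g] &&
                   (join_edges (block j) [set x in codom g] \subset edges G))
         (iota 0 M).
apply: (@le_trans _ _ (\sum_(g in ffun_on (mem Y)) gnp_prob p (fails g))).
  apply: le_trans (gnp_prob_exists p_ge0 p_le1 _ _).
  apply: le_gnp_prob => // G /=; rewrite negb_forall => /existsP[g].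
  by rewrite negb_imply => gG; apply/existsP; exists g.
rewrite -[X in (_ ^ X)%N](card_ord d.+2) -card_ffun_on mulr_natl -sumr_const.
apply: ler_sum => g _.
pose S := [set x in codom g].
have Sd : (#|S| <= d.+2)%N.
  rewrite cardsE (leq_trans (card_size _)) // size_codom card_ord //.
pose js := [seq j <- iota 0 M | [disjoint block j & codom g]].
have js_size : (M - d.+2 <= size js)%N.
  have -> : size js = (M - size [seq j <- iota 0 M | ~~ [disjoint block j & codom g]])%N.
    apply: (canRL (addnK _)); rewrite !size_filter.
    by rewrite -[RHS](size_iota 0 M) -(count_predC (fun j => [disjoint block j & codom g])).
  (* Each excluded block contains a vertex of [S], so at most [#|S|] of them are excluded. *)
  rewrite leq_sub2l // (leq_trans _ Sd) // cardE -(size_map (fun i : 'I_n => i %/ d)%N).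
  apply: uniq_leq_size; first by rewrite filter_uniq ?iota_uniq.
  move=> j; rewrite mem_filter => /andP[/pred0Pn[i /andP[/= ij ig]] _].
  apply/mapP; exists i; rewrite ?mem_enum ?inE //.
  by move: ij; rewrite inE => /eqP.
have q01 c : 0 <= 1 - p ^+ c <= 1.
  by rewrite subr_ge0 exprn_ile1 // lerBlDr lerDl exprn_ge0.
have /andP[q0 q1] := q01 ((d + #|S|) ^ 2)%N.
apply: (@le_trans _ _ ((1 - p ^+ ((d + #|S|) ^ 2)) ^+ size js)).
  apply: (@le_trans _ _ (gnp_prob p [pred G : sgraph 'I_n |
      all (fun j => ~~ (join_edges (block j) S \subset edges G)) js])).
    apply: le_gnp_prob => // G; rewrite /fails -all_predC /= => /allP h.
    apply/allP => j; rewrite mem_filter => /andP[dj /h].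
    by rewrite /= dj.
  apply: gnp_prob_no_join_block => [|j]; first by rewrite filter_uniq ?iota_uniq.
  rewrite mem_filter mem_iota => /andP[dj /= jM]; split.
    by rewrite (leq_trans _ Mn) // leq_mul2r jM orbT.
  by rewrite (eq_disjoint_r (in_set _)).
have /andP[r0 r1] := q01 ((d + d.+2) ^ 2)%N.
apply: (le_trans (ler_wiXn2l q0 q1 js_size)).
rewrite lerXn2r ?nnegrE // lerD2l lerN2 ler_wiXn2l //.
by rewrite leq_exp2r // leq_add2l.
Qed.

Definition has_core M1 M2 (G : sgraph 'I_n) :=
  has (fun j => join_edges (block j) (initial_blocks M1) \subset edges G)
      (iota M2 (n %/ d - M2)).

Lemma gnp_prob_core M1 M2 : (M1 <= M2)%N -> (M2 * d <= n)%N ->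
  gnp_prob p [pred G | ~~ has_core M1 M2 G] <=
  (1 - p ^+ ((M1.+1 * d) ^ 2)) ^+ (n %/ d - M2).
Proof.
move=> M12 M2n; have M1n : (M1 * d <= n)%N by rewrite (leq_trans _ M2n) ?leq_mul.
(* A block has [d] vertices and the first layer [M1 * d], together [M1.+1 * d]. *)
rewrite -[X in _ <= _ ^+ X](size_iota M2) mulSn -(card_initial_blocks M1n).
under eq_gnp_prob => G do rewrite /= /has_core -all_predC.
apply: gnp_prob_no_join_block => [|j]; first exact: iota_uniq.
rewrite mem_iota => /andP[M2j jn]; split.
  by rewrite -leq_divRL //; lia.
by apply/disjoint_blockP => i; rewrite inE; lia.
Qed.

(** With [Z1] and [Z] the first [M1] and [M2] blocks, the subtracted terms bound the failure of [Z1]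
    to absorb [Z], of [Z] to absorb all vertices, and of a core to exist. *)
Lemma gnp_prob_wsat_ge M1 M2 : (M1 <= M2)%N -> (M2 * d <= n)%N ->
  1 - ((M2 * d) ^ d.+2)%:R * (1 - p ^+ ((d + d.+2) ^ 2)) ^+ (M1 - d.+2)
    - (n ^ d.+2)%:R * (1 - p ^+ ((d + d.+2) ^ 2)) ^+ (M2 - d.+2)
    - (1 - p ^+ ((M1.+1 * d) ^ 2)) ^+ (n %/ d - M2)
  <= gnp_prob p [pred G : sgraph 'I_n |
       (wsat (complete_graph 'I_d.+2) G + 'C(n - d, 2) == 'C(n, 2))%N].
Proof.
move=> M12 M2n; have M1n : (M1 * d <= n)%N by rewrite (leq_trans _ M2n) ?leq_mul.
have h1 := gnp_prob_absorbs (initial_blocks M2) M1n.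
have h2 := gnp_prob_absorbs [set: 'I_n] M2n.
have h3 := gnp_prob_core M12 M2n.
rewrite card_initial_blocks // in h1; rewrite cardsT card_ord in h2.
rewrite [leRHS](gnp_probC _ _) -!addrA lerD2l -!opprD lerN2 !addrA.
apply: le_trans (lerD (lerD h1 h2) h3).
apply: le_trans (lerD (gnp_probU p_ge0 p_le1 _ _) (lexx _)).
apply: le_trans (gnp_probU p_ge0 p_le1 _ _).
apply: le_gnp_prob => // G /=; apply: contraR; rewrite !negb_or !negbK.
case/andP=> /andP[ab1 ab2] /hasP[j].
rewrite mem_iota => /andP[M2j jn] jG.
apply/eqP/(@wsat_cliqueE _ _ _ (block j) (initial_blocks M1) (initial_blocks M2)) => //.
- by apply: card_block; rewrite -leq_divRL //; lia.
- by apply/disjoint_blockP => i; rewrite inE; lia.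
- by apply/subsetP => i; rewrite !inE => /leq_trans->.
- exact: absorbsP.
- exact: absorbsP.
Qed.

End Blocks.

(** * Decay of the failure probabilities *)

Lemma exp_self_le k E : (0 < E)%N -> (k ^ E <= E ^ E * 2 ^ k)%N.
Proof.
(* With [j = k %/ E], combine [k < E * (j + 1)] and [j + 1 <= 2 ^ j], then raise to the power
   [E]. *)
move=> E0; have kE : (k <= E * 2 ^ (k %/ E))%N.
  rewrite (leq_trans (ltnW (ltn_ceil k E0))) // mulnC leq_mul2l.
  by rewrite (ltn_expl _ (ltnSn 1)) orbT.
rewrite -(leq_exp2r _ _ E0) expnMn -expnM in kE; apply: leq_trans kE _.
by rewrite leq_mul2l leq_exp2l // leq_trunc_div orbT.
Qed.

Lemma poly_le_exp2 A e : exists Y, forall y, (Y <= y)%N -> (A * y.+1 ^ e <= 2 ^ y)%N.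
Proof.
(* The spare factor [y + 1] in [(y + 1) ^ E] absorbs the constant [2 * A * E ^ E]. *)
set E := e.+1; exists (2 * A * E ^ E)%N => y Yy.
have EE : (0 < 2 * E ^ E)%N by rewrite muln_gt0 expn_gt0.
rewrite -(leq_pmul2l EE); apply: (@leq_trans (y.+1 ^ E)).
  by rewrite (expnS y.+1) mulnA leq_mul2r mulnAC (leq_trans Yy) ?orbT.
by rewrite (leq_trans (exp_self_le _ _)) // (expnS 2) mulnCA mulnA.
Qed.

(** The scale makes [log n] of order [k ^ 3]: about [k ^ 4] trials beat a union bound over
    [n ^ d.+2] functions, while a core over [k] blocks needs only order [k ^ 2] edges and is likely
    among about [n / d] candidates. *)
Lemma cube_sandwich n K : (2 ^ K ^ 3 <= n)%N ->
  exists2 k, (K <= k)%N & (2 ^ k ^ 3 <= n < 2 ^ k.+1 ^ 3)%N.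
Proof.
move=> Kn.
have bound k : (2 ^ k ^ 3 <= n)%N -> (k <= n)%N.
  move=> kn; rewrite (leq_trans _ kn) // ltnW // (leq_ltn_trans _ (ltn_expl _ _)) //.
  by case: k {kn} => // k; rewrite -{1}(expn1 k.+1) leq_pexp2l.
case: (ex_maxnP (ex_intro (fun k => 2 ^ k ^ 3 <= n)%N K Kn) bound) => k kn kmax.
exists k; first exact: kmax.
by rewrite kn /= ltnNge; apply/negP => /kmax; rewrite ltnn.
Qed.

(** In the induction, [1 + N x] exceeds [(1 - x) (1 + (N + 1) x)] by [(N + 1) x ^ 2]. *)
Lemma bernoulli_le (R : realFieldType) (x : R) N : 0 <= x <= 1 ->
  (1 - x) ^+ N * (1 + N%:R * x) <= 1.
Proof.
move=> /andP[x0 x1]; elim: N => [|N IH]; first by rewrite expr0 mul0r addr0 mulr1.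
apply: le_trans IH; rewrite exprSr -mulrA ler_wpM2l ?exprn_ge0 ?subr_ge0 //.
rewrite -natr1; have : 0 <= (N%:R + 1) * x * x by rewrite !mulr_ge0 // addr_ge0.
lra.
Qed.

Lemma expr_decay (R : realFieldType) (x : R) N a : 0 <= x <= 1 ->
  (2 ^ a)%:R <= N%:R * x -> (1 - x) ^+ N <= ((2 ^ a)%:R)^-1.
Proof.
move=> x01 aN; have a0 : 0 < (2 ^ a)%:R :> R by rewrite ltr0n expn_gt0.
rewrite -[leRHS]mul1r ler_pdivlMr // (le_trans _ (bernoulli_le N x01)) //.
rewrite ler_wpM2l ?exprn_ge0 ?subr_ge0 //; first by case/andP: x01.
by rewrite (le_trans aN) // lerDr.
Qed.

(** Since [k] is at most linear in the exponent [y] on the right, this compares a polynomial with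
    [2 ^ y]. *)
Lemma absorb_decay_small d m c : (0 < c)%N -> exists K, forall k, (K <= k)%N ->
  ((k ^ 4 * d) ^ d.+2 * 2 ^ m <= 2 ^ ((k - d.+2) %/ c))%N.
Proof.
move=> c0; pose A := ((c + d.+2) ^ (4 * d.+2) * d ^ d.+2 * 2 ^ m)%N.
have [Y HY] := poly_le_exp2 A (4 * d.+2).
exists (Y * c + d.+2)%N => k Kk.
have Yy : (Y <= (k - d.+2) %/ c)%N by rewrite leq_divRL //; lia.
apply: leq_trans (HY _ Yy); move: {Yy HY}((k - d.+2) %/ c)%N (ltn_ceil (k - d.+2) c0).
move=> y ky.
have ky' : (k <= (c + d.+2) * y.+1)%N by nia.
have h : (k ^ (4 * d.+2) <= (c + d.+2) ^ (4 * d.+2) * y.+1 ^ (4 * d.+2))%N.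
  by rewrite -expnMn leq_exp2r.
rewrite expnMn -expnM /A (leq_trans (leq_mul (leq_mul h (leqnn _)) (leqnn _))) //.
by rewrite (mulnAC _ (_ ^ _)%N (d ^ _)%N) (mulnAC _ (_ ^ _)%N (2 ^ m)%N).
Qed.

(** Serves the union bound over [n ^ d.+2] with [n < 2 ^ k.+1 ^ 3]: [k ^ 4] outgrows [(k + 1) ^ 3],
    which is at most [8 * k ^ 3]. *)
Lemma absorb_decay_large d m c : (0 < c)%N -> exists K, forall k, (K <= k)%N ->
  (k.+1 ^ 3 * d.+2 + m <= (k ^ 4 - d.+2) %/ c)%N.
Proof.
move=> c0; exists (c * (8 * d.+2 + m) + d.+2)%N => k Kk.
rewrite leq_divRL //.
have k0 : (0 < k)%N by lia.
have k3 : (k.+1 ^ 3 <= 8 * k ^ 3)%N.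
  by rewrite (_ : 8 = 2 ^ 3)%N // -expnMn leq_exp2r //; lia.
have k31 : (0 < k ^ 3)%N by rewrite expn_gt0 k0.
have k4 : ((c * (8 * d.+2 + m) + d.+2) * k ^ 3 <= k ^ 4)%N.
  by rewrite (expnS k 3) leq_mul2r Kk orbT.
move: (k ^ 3)%N (k ^ 4)%N (k.+1 ^ 3)%N k3 k31 k4 => x y z zx x0 xy.
have h1 : (z * d.+2 + m <= (8 * d.+2 + m) * x)%N by nia.
have h2 : ((z * d.+2 + m) * c <= (8 * d.+2 + m) * x * c)%N by rewrite leq_mul2r h1 orbT.
have h3 : ((c * (8 * d.+2 + m) + d.+2) * x = (8 * d.+2 + m) * x * c + d.+2 * x)%N by ring.
nia.
Qed.

Lemma core_decay d m c : exists K, forall k, (K <= k)%N ->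
  (d * (2 ^ (m + c * (k.+1 * d) ^ 2) + k ^ 4) <= 2 ^ k ^ 3)%N.
Proof.
(* In the exponent, [4 * c * d ^ 2] comes from [(k + 1) ^ 2 <= 4 * k ^ 2], and [5] from
   [k ^ 4 <= 2 ^ (4 * k)] and one doubling. *)
exists (d + m + 4 * c * d ^ 2 + 5)%N => k Kk.
have k0 : (0 < k)%N by lia.
have kexp j : (j <= 2 ^ j)%N by rewrite ltnW // ltn_expl.
set E := (m + _)%N.
apply: (@leq_trans (2 ^ d * 2 ^ (E + 4 * k).+1)).
  rewrite leq_mul // (expnS 2) mul2n -addnn leq_add //.
    by rewrite leq_exp2l // leq_addr.
  apply: (@leq_trans (2 ^ (4 * k))); last by rewrite leq_exp2l // leq_addl.
  by rewrite mulnC expnM leq_exp2r.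
rewrite -expnD leq_exp2l // /E expnMn.
have k2 : (k.+1 ^ 2 <= 4 * k ^ 2)%N.
  by rewrite (_ : 4 = 2 ^ 2)%N // -expnMn leq_exp2r //; lia.
have k21 : (k <= k ^ 2)%N by rewrite -{1}(expn1 k) leq_pexp2l.
have k3 : ((d + m + 4 * c * d ^ 2 + 5) * k ^ 2 <= k ^ 3)%N.
  by rewrite (expnS k 2) leq_mul2r Kk orbT.
apply: leq_trans k3.
have h1 : (c * (k.+1 ^ 2 * d ^ 2) <= c * (4 * k ^ 2 * d ^ 2))%N.
  by rewrite leq_mul2l leq_mul2r k2 !orbT.
move: (k ^ 2)%N (k.+1 ^ 2)%N (d ^ 2)%N h1 k21 {k2} => x z w h1 kx.
have h2 : ((d + m + 4 * c * w + 5) * x = c * (4 * x * w) + (d + m + 5) * x)%N by ring.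
rewrite h2; nia.
Qed.

Lemma ler_mul_inv_exp2 (R : realFieldType) (r : R) X m y :
  r <= ((2 ^ y)%:R)^-1 -> (X * 2 ^ m <= 2 ^ y)%N -> X%:R * r <= ((2 ^ m)%:R)^-1.
Proof.
move=> ry Xy; have pos a : 0 < (2 ^ a)%:R :> R by rewrite ltr0n expn_gt0.
apply: (le_trans (ler_wpM2l (ler0n _ X) ry)).
by rewrite ler_pdivrMr // mulrC -[leRHS]/(_ / _) ler_pdivlMr // -natrM ler_nat.
Qed.

Lemma natr_bound_exp2 (R : realType) (x : R) : exists c, x <= (2 ^ c)%:R.
Proof.
have [x0|x0] := lerP 0 x; last by exists 0; rewrite (le_trans (ltW x0)).
exists (Num.bound x); apply: (le_trans (ltW (archi_boundP x0))).
by rewrite ler_nat ltnW // ltn_expl.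
Qed.

Lemma gnp_prob_wsat_lim (R : realType) (p : R) d m :
  0 < p -> p < 1 -> (0 < d)%N -> exists N, forall n, (N <= n)%N ->
  (d <= n)%N /\ 1 - 3 / (2 ^ m)%:R <=
    gnp_prob p [pred G : sgraph 'I_n |
       (wsat (complete_graph 'I_d.+2) G + 'C(n - d, 2) == 'C(n, 2))%N].
Proof.
move=> p0 p1 d0; set q := p ^+ ((d + d.+2) ^ 2).
have pX a : 0 <= p ^+ a <= 1 by rewrite exprn_ge0 ?exprn_ile1 ?ltW.
have q0 : 0 < q by rewrite exprn_gt0.
have [c1 pc1] := natr_bound_exp2 p^-1.
have [a qa] := natr_bound_exp2 (2 / q).
(* Since [c2 * q] is at least [2], every [c2] trials at least halve the failure probability. *)
pose c2 := (2 ^ a)%N; have c20 : (0 < c2)%N by rewrite expn_gt0.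
have qdecay e : (1 - q) ^+ e <= ((2 ^ (e %/ c2))%:R)^-1.
  have /andP[_ q1] := pX ((d + d.+2) ^ 2)%N.
  apply: (@le_trans _ _ (((1 - q) ^+ c2) ^+ (e %/ c2))).
    rewrite -exprM ler_wiXn2l ?subr_ge0 // ?lerBlDr ?lerDl ?(ltW q0) //.
    by rewrite mulnC leq_trunc_div.
  have half : (1 - q) ^+ c2 <= ((2 ^ 1)%:R)^-1.
    by apply: expr_decay; rewrite ?pX // expn1 -ler_pdivrMr.
  by rewrite natrX -exprVn lerXn2r ?nnegrE ?exprn_ge0 ?subr_ge0 ?invr_ge0.
have [K1 HK1] := absorb_decay_small d m c20.
have [K2 HK2] := absorb_decay_large d m c20.
have [K3 HK3] := core_decay d m c1.
exists (2 ^ (K1 + K2 + K3 + 1) ^ 3)%N => n /cube_sandwich[k Kk /andP[nk kn]].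
have {}HK3 := HK3 k ltac:(lia).
have dn : (d * (2 ^ (m + c1 * (k.+1 * d) ^ 2) + k ^ 4) <= n)%N by apply: leq_trans nk.
have k4n : (k ^ 4 * d <= n)%N by rewrite (leq_trans _ dn) // mulnC leq_mul2l leq_addl orbT.
have k14 : (k <= k ^ 4)%N by rewrite -{1}(expn1 k) leq_pexp2l //; lia.
split; first by rewrite (leq_trans _ k4n) // leq_pmull // expn_gt0; lia.
apply: le_trans (gnp_prob_wsat_ge d0 (ltW p0) (ltW p1) k14 k4n).
rewrite -/q.
have h1 : ((k ^ 4 * d) ^ d.+2)%:R * (1 - q) ^+ (k - d.+2) <= ((2 ^ m)%:R)^-1.
  by apply: ler_mul_inv_exp2 (qdecay _) _; apply: HK1; lia.
have h2 : (n ^ d.+2)%:R * (1 - q) ^+ (k ^ 4 - d.+2) <= ((2 ^ m)%:R)^-1.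
  apply: ler_mul_inv_exp2 (qdecay _) _.
  apply: (@leq_trans (2 ^ (k.+1 ^ 3 * d.+2 + m))); last first.
    by rewrite leq_exp2l // HK2 //; lia.
  by rewrite expnD leq_mul2r expnM leq_exp2r // (ltnW kn) orbT.
have h3 : (1 - p ^+ ((k.+1 * d) ^ 2)) ^+ (n %/ d - k ^ 4) <= ((2 ^ m)%:R)^-1.
  apply: expr_decay => //; set e := ((k.+1 * d) ^ 2)%N.
  have pe : ((2 ^ (c1 * e))%:R)^-1 <= p ^+ e.
    rewrite expnM natrX -exprVn lerXn2r ?nnegrE ?invr_ge0 ?(ltW p0) //.
    by rewrite -[leRHS]invrK lef_pV2 ?posrE ?invr_gt0 // ltr0n expn_gt0.
  apply: le_trans (ler_wpM2l (ler0n _ _) pe).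
  rewrite ler_pdivlMr ?ltr0n ?expn_gt0 // -natrM ler_nat -expnD.
  by rewrite leq_subRL ?leq_divRL // mulnC // addnC.
lra.
Qed.

(** * The closed formula and the limit *)

Lemma wsat_formulaE n d w : (d <= n)%N -> (w + 'C(n - d, 2) = 'C(n, 2))%N ->
  w%:Z = (d.+2%:Z - 2) * n%:Z - 'C(d.+2 - 1, 2)%:Z.
Proof.
move=> dn; rewrite -{2}(subnKC dn) bin2D => /addIn wE.
have dd : (2 * 'C(d, 2) + d = d * d)%N.
  by elim: d {dn wE} => // d IH; rewrite binS bin1; lia.
rewrite subn1 /= binS bin1 wE; nia.
Qed.

From mathcomp Require Import all_classical all_reals all_analysis.
Import numFieldNormedType.Exports.
Local Open Scope classical_set_scope.

Theorem theorem1p3 (R : realType) (p : R) (s : nat)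
    (p_gt0 : 0 < p) (p_lt1 : p < 1) (s_ge3 : (3 <= s)%N) :
  (fun n : nat =>
     gnp_prob p [pred G : sgraph 'I_n |
       (wsat (complete_graph 'I_s) G)%:Z
         == (s%:Z - 2) * n%:Z - 'C(s - 1, 2)%:Z]) @ \oo --> (1 : R).
Proof.
(* From here on [s - 2] is [d.+1], positive as the blocks require. *)
case: s s_ge3 => [|[|[|d]]] // _.
have p_ge0 := ltW p_gt0; have p_le1 := ltW p_lt1.
apply/cvgrPdist_le => e e0.
(* This [m] makes the error [3 / 2 ^ m] at most [e]. *)
have [m em] := natr_bound_exp2 (3 / e).
have [N HN] := gnp_prob_wsat_lim m p_gt0 p_lt1 (ltn0Sn d).
exists N => // n /= /HN[dn h].
rewrite ger0_norm; last first.
  by rewrite subr_ge0 -(gnp_prob_total n p) le_gnp_prob.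
rewrite lerBlDr -lerBlDl; apply: le_trans (le_trans h _).
  by rewrite lerB // ler_pdivrMr ?ltr0n ?expn_gt0 // mulrC -ler_pdivrMr.
by apply: le_gnp_prob => // G /= /eqP/(wsat_formulaE dn)->.
Qed.
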